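(* Let $D$ be an oriented twisted knot diagram. Suppose that for every classical crossing $c$ of $D$, each component of the smoothed diagram $D_c$ contains either exactly one arc or an even number of arcs. Then $$\mathcal{B}_{\overline{D}}(t)=\mathcal{B}_D(t),$$ where $\overline{D}$ denotes the diagram obtained from $D$ by reversing its orientation.
   Context: Twisted diagrams. A twisted link diagram is a generic immersion of circles in the plane in which every double point is either a classical crossing (with over/under information) or a virtual crossing, together with finitely many bars (short transverse marks) placed on edges away from the crossings. A twisted knot diagram has one circle. Sign. $\operatorname{sgn}(c)=+1$ if the under-strand direction is obtained from the over-strand direction by a counterclockwise rotation by an angle less than $\pi$, and $-1$ otherwise. Arcs. In an oriented diagram, a component with at most one bar is regarded as a single arc; otherwise the arcs of a component are its segments between two consecutive bars. For an arc $C$, $\langle C=C_1,\dots,C_n\rangle$ denotes the sequence of all arcs of the component containing $C$, in the order met when travelling along the orientation starting from $C$. Linking sets. In a two-component oriented diagram $L$, a linking crossing is a classical crossing between different components. For an arc $C$, $\mathcal{O}(C)$ (resp. $\mathcal{U}(C)$) is the set of linking crossings met as overcrossings (resp. undercrossings) when traversing $C$. With $\langle C=C_1,\dots,C_n\rangle$ the sequence of all arcs of the component of $L$ containing $C$, in the order met when travelling along the orientation starting from $C$, $\mathcal{O}_L(L:C)=\mathcal{O}(C_1)\cup\mathcal{U}(C_2)\cup\mathcal{O}(C_3)\cup\cdots$ and $\mathcal{U}_L(L:C)=\mathcal{U}(C_1)\cup\mathcal{O}(C_2)\cup\mathcal{U}(C_3)\cup\cdots$, alternating through $C_n$. Indices.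 Let $c$ be a classical crossing of an oriented twisted knot diagram $D$. Put a base point $\alpha$ on the incoming part of the under strand and a base point $\beta$ on the incoming part of the over strand, both immediately before $c$. Smoothing $c$ along the orientation (incoming under strand joined to outgoing over strand, incoming over strand joined to outgoing under strand) gives an oriented two-component diagram $D_c$. Let $C$, $C'$ be the arcs of $D_c$ containing $\alpha$, $\beta$ respectively. Then $\operatorname{Ind}^1(c)=\sum_{x\in\mathcal{O}_L(D_c:C)}\operatorname{sgn}(x)-\sum_{x\in\mathcal{U}_L(D_c:C)}\operatorname{sgn}(x)$, and $\operatorname{Ind}^2(c)$ is the same expression with $C'$ in place of $C$. $\mathcal{B}$-Index polynomial. $\mathcal{B}_D(t)=\sum_{c\in\mathcal{C}(D)}\operatorname{sgn}(c)\left(t^{\operatorname{Ind}^1(c)+\operatorname{Ind}^2(c)}-1\right)$, where $\mathcal{C}(D)$ is the set of classical crossings of $D$. *)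

(* Defs.v *)
From HB Require Import structures.
From mathcomp Require Import all_boot all_order all_algebra.

Set Implicit Arguments.
Unset Strict Implicit.
Unset Printing Implicit Defensive.

Import GRing.Theory.

(* A diagram is recorded, up to isotopy of the plane, as an oriented          *)
(* combinatorial map. The darts are the ends of the edges; [rot] is the       *)
(* counterclockwise successor of a dart around its vertex, [edge] is the      *)
(* other end of the edge. Crossings are 4-valent vertices, and bars are       *)
(* 2-valent vertices. [Plain] vertices are 2-valent subdivision points that   *)
(* carry no information: they allow circles with neither crossings nor bars.  *)
Variant vkind := Classical | Virtual | Bar | Plain.

Definition is_classical k := if k is Classical then true else false.
Definition is_bar k := if k is Bar then true else false.
Definition valence k : nat :=
  match k with Classical | Virtual => 4 | Bar | Plain => 2 end.

Record diagram := Diagram {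
  dart : finType;
  kind : dart -> vkind;
  rot : dart -> dart;
  edge : dart -> dart;
  is_over : dart -> bool; (* only meaningful at classical crossings *)
  is_out : dart -> bool   (* the orientation points away from the vertex *)
}.

Definition opposite (D : diagram) (d : dart D) : dart D :=
  iter (valence (kind d))./2 (@rot D) d.

Record twisted_link_diagram (D : diagram) : Prop := {
  rot_injective : injective (@rot D);
  order_rot : forall d : dart D, order (@rot D) d = valence (kind d);
  kind_rot : forall d : dart D, kind (rot d) = kind d;
  over_rot : forall d : dart D,
    is_classical (kind d) -> is_over (rot d) = ~~ is_over d;
  edge_involutive : involutive (@edge D);
  edge_neq : forall d : dart D, edge d != d;
  out_edge : forall d : dart D, is_out (edge d) = ~~ is_out d;
  out_opposite : forall d : dart D, is_out (opposite d) = ~~ is_out d;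
  (* Euler's formula: vertices + faces = edges + 2 * connected components *)
  euler_planar :
    (fcard (@rot D) (dart D) + fcard (@rot D \o @edge D) (dart D) =
     fcard (@edge D) (dart D) +
     (n_comp [rel x y : dart D | (rot x == y) || (edge x == y)] (dart D)).*2)%N
}.

(* An edge, and also the passage through the vertex where this edge starts,   *)
(* is represented by the outgoing dart of the edge; [travel] goes from an     *)
(* edge to the following one. Components and arcs are sets of outgoing darts. *)
Definition travel (D : diagram) (d : dart D) : dart D := opposite (edge d).

Definition component (D : diagram) (d : dart D) : {set dart D} :=
  [set e | fconnect (@travel D) d e].

Definition components (D : diagram) : {set {set dart D}} :=
  [set component d | d in [pred d : dart D | is_out d]].

Definition twisted_knot_diagram (D : diagram) : Prop :=
  twisted_link_diagram D /\ #|components D| = 1.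

Definition reverse (D : diagram) : diagram :=
  Diagram (@kind D) (@rot D) (@edge D) (@is_over D) (fun d => ~~ is_out d).

Definition vertex (D : diagram) (d : dart D) : {set dart D} :=
  [set e | fconnect (@rot D) d e].

Definition crossings (D : diagram) : {set {set dart D}} :=
  [set vertex d | d in [pred d : dart D | is_classical (kind d)]].

(* Positive when the outgoing under dart follows the outgoing over dart       *)
(* counterclockwise.                                                          *)
Definition sgn (D : diagram) (c : {set dart D}) : int :=
  if [exists d in c, [&& is_over d, is_out d & is_out (rot d)]] then 1%R
  else (-1)%R.

Definition same_arc_step (D : diagram) : rel (dart D) :=
  [rel x y | ((travel x == y) && ~~ is_bar (kind y))
          || ((travel y == x) && ~~ is_bar (kind x))].

Definition arc_of (D : diagram) (d : dart D) : {set dart D} :=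
  if #|[set e in component d | is_bar (kind e)]| <= 1 then component d
  else [set e | connect (@same_arc_step D) d e].

Definition arcs (D : diagram) (K : {set dart D}) : {set {set dart D}} :=
  [set arc_of d | d in K].

(* [undup] keeps last occurrences, hence the two reversals: the arcs are      *)
(* listed in the order in which they are first met.                           *)
Definition arcs_from (D : diagram) (d : dart D) : seq {set dart D} :=
  rev (undup (rev [seq arc_of e | e <- orbit (@travel D) d])).

Definition linking (D : diagram) (x : {set dart D}) : bool :=
  [exists d in x, [exists e in x,
     [&& is_out d, is_out e & component d != component e]]].

Definition over_set (D : diagram) (C : {set dart D}) : {set {set dart D}} :=
  [set x in crossings D |
     linking x & [exists d in x, (d \in C) && is_over d]].

Definition under_set (D : diagram) (C : {set dart D}) : {set {set dart D}} :=
  [set x in crossings D |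
     linking x & [exists d in x, (d \in C) && ~~ is_over d]].

(* O_L(D : C) and U_L(D : C) for the arc C = arc_of d. Positions in           *)
(* [arcs_from d] are counted from 0, so that C itself has position 0.         *)
Definition OL (D : diagram) (d : dart D) : {set {set dart D}} :=
  \bigcup_(i < size (arcs_from d))
    (if odd i then under_set (nth set0 (arcs_from d) i)
     else over_set (nth set0 (arcs_from d) i)).

Definition UL (D : diagram) (d : dart D) : {set {set dart D}} :=
  \bigcup_(i < size (arcs_from d))
    (if odd i then over_set (nth set0 (arcs_from d) i)
     else under_set (nth set0 (arcs_from d) i)).

(* The four darts of c become two plain vertices, each joining the two        *)
(* neighbouring darts with opposite directions. As c is 4-valent,             *)
(* [iter 3 rot] is the inverse of [rot] there.                                *)
Definition smoothing (D : diagram) (c : {set dart D}) : diagram :=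
  @Diagram (dart D)
    (fun d => if d \in c then Plain else kind d)
    (fun d => if (d \in c) && (is_out (rot d) == is_out d)
              then iter 3 (@rot D) d else rot d)
    (@edge D) (@is_over D) (@is_out D).

Definition index_at (D : diagram) (d : dart D) : int :=
  (\sum_(x in OL d) sgn x - \sum_(x in UL d) sgn x)%R.

(* The base point lies on the edge that enters c through the incoming dart d; *)
(* that edge is represented by its outgoing dart [edge d].                    *)
Definition Ind (D : diagram) (on_over : bool) (c : {set dart D}) : int :=
  if [pick d in c | (is_over d == on_over) && ~~ is_out d] is Some d
  then @index_at (smoothing c) (edge d) else 0%R.

Definition Ind1 (D : diagram) (c : {set dart D}) : int := Ind false c.
Definition Ind2 (D : diagram) (c : {set dart D}) : int := Ind true c.

(* Laurent polynomials in t = tofrac 'X, in the field of rational functions.  *)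
Definition Bpoly (D : diagram) : {fraction {poly int}} :=
  (\sum_(c in crossings D)
     (sgn c)%:~R * (tofrac 'X ^ (Ind1 c + Ind2 c) - 1))%R.

(* Main.v *)
(* Reversing the orientation turns the base point on the incoming under       *)
(* strand of c into a point of the outgoing under strand, which in the        *)
(* smoothed diagram lies on the arc of the incoming over strand; hence        *)
(* Ind^1 of the reversed diagram should be Ind^2 of the original one, and     *)
(* conversely. Signs are invariant, so the point is that the sets O_L and U_L *)
(* from a given arc do not depend on the direction of travel. The arcs of a   *)
(* component are C_1, ..., C_n in one direction and C_1, C_n, ..., C_2 in     *)
(* the other; when n is even or n = 1, an arc has positions of the same       *)
(* parity in both lists, since for even n the alternation is the unique       *)
(* two-colouring of the component that changes exactly at the bars.           *)
Require Import Defs.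
From HB Require Import structures.
From mathcomp Require Import all_boot all_order all_algebra.
From mathcomp Require Import zify.
From Stdlib Require Import FunctionalExtensionality.

Set Implicit Arguments.
Unset Strict Implicit.
Unset Printing Implicit Defensive.

Import GRing.Theory.

(** * Order of first occurrences *)

(** Reversal commutes with smoothing, and smoothing joins each incoming end of c to the outgoing end
    of the other strand through a plain vertex. So each base point of the reversed diagram lies on
    the same arc as the other base point of the original one. Once the index seen from an arc is
    known to ignore the direction of travel ([index_at_reverse]), Ind^1 and Ind^2 are exchanged
    ([Ind_reverse]), signs are kept ([sgn_reverse]), and the symmetric sum Ind^1 + Ind^2 does not
    change.

    For the index, numbering arcs in the order met amounts to counting bars modulo their number
    ([arcs_from_bars]). If that number is even, the parity of the position flips at every bar all
    round the circle; with at most one bar it is constant ([alternation_travel]). This local rule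
    reads the same in both directions, so the parities agree once they agree at the start
    ([alternation_edge]), and O_L and U_L depend on these parities only ([linking_setP]).

    Since [travel] does not mention [is_out], one function serves both orientations: the component
    of [d] run backwards is the component of [edge d]. *)

Definition first_occurrences (T : eqType) (s : seq T) : seq T :=
  rev (undup (rev s)).

Lemma first_occurrences_rcons (T : eqType) (s : seq T) (x : T) :
  first_occurrences (rcons s x) =
  if x \in s then first_occurrences s else rcons (first_occurrences s) x.
Proof.
by rewrite /first_occurrences rev_rcons /= mem_rev; case: ifP; rewrite ?rev_cons.
Qed.

Lemma mem_first_occurrences (T : eqType) (s : seq T) :
  first_occurrences s =i s.
Proof. by move=> x; rewrite /first_occurrences mem_rev mem_undup mem_rev. Qed.

Lemma first_occurrences_uniq (T : eqType) (s : seq T) :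
  uniq (first_occurrences s).
Proof. by rewrite rev_uniq undup_uniq. Qed.

(** Here [g i] stands for the arc reached after [i] steps and [N i] for the number of bars passed.
    After the first term, a value is new exactly when [N] rises to a number below [k], which is then
    its index; when [N] reaches [k], the first value returns. *)
Lemma cyclic_first_occurrences (T : eqType) (g : nat -> T) (N : nat -> nat)
    (k n : nat) :
  0 < k -> N 0 = 0 -> (forall i, N i <= N i.+1 <= (N i).+1) -> N n = k ->
  (forall i j, i < n -> j < n -> (g i == g j) = (N i == N j %[mod k])) ->
  size (first_occurrences (mkseq g n)) = k /\
  forall i, i < n -> index (g i) (first_occurrences (mkseq g n)) = N i %% k.
Proof.
move=> k_gt0 N0 Nstep Nn gE.
have Nmono i j : i <= j -> N i <= N j.
  move=> /subnK <-; elim: (j - i) => [|m IHm] //=.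
  by rewrite addSn (leq_trans IHm) //; case/andP: (Nstep (m + i)).
(* The minimum is needed because [N] may reach [k] before the last term, and this adds no new
   value. *)
have claim m : m < n ->
    size (first_occurrences (mkseq g m.+1)) = minn k (N m).+1 /\
    forall i, i < m.+1 ->
      index (g i) (first_occurrences (mkseq g m.+1)) = N i %% k.
  elim: m => [|m IHm] lt_m.
    rewrite /first_occurrences /= N0; split; first by lia.
    by case=> // _; rewrite eqxx N0 mod0n.
  have [sizeE indexE] := IHm (ltnW lt_m).
  have le_k i : i < n -> N i <= k by move=> /ltnW /Nmono; rewrite Nn.
  rewrite mkseqS first_occurrences_rcons; case: ifP => [g_in | /negbT g_notin].
    have [j lt_j gj] : exists2 j, j < m.+1 & g m.+1 = g j.
      case/mapP: g_in => j; rewrite mem_iota => /andP[_ lt_j] ->.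
      by exists j.
    have NE : N m.+1 = N j %[mod k].
      by apply/eqP; rewrite -gE ?gj //; apply: ltn_trans lt_m.
    have le_Nj : N j <= N m by apply: Nmono.
    have step_m := Nstep m.
    split=> [|i].
      rewrite sizeE; have := le_k _ lt_m; rewrite leq_eqVlt => /orP[/eqP | ltk].
        by lia.
      by move: NE; rewrite !modn_small; lia.
    rewrite ltnS leq_eqVlt => /orP[/eqP-> | lt_i]; last exact: indexE.
    by rewrite gj indexE.
  have neq j : j < m.+1 -> N m.+1 != N j %[mod k].
    move=> lt_j; rewrite -gE ?(ltn_trans lt_j) //.
    by apply: contraNneq g_notin => ->; apply/map_f; rewrite mem_iota.
  (* The value [k] would be congruent to [N 0], so the term would not be new. *)
  have ltk : N m.+1 < k.
    rewrite ltn_neqAle le_k // andbT.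
    by apply: contraNneq (neq 0 isT) => ->; rewrite N0 modnn mod0n.
  have NS : N m.+1 = (N m).+1.
    have := Nstep m; have := neq m (leqnn _); case: (eqVneq (N m) (N m.+1)).
      by move=> ->; rewrite eqxx.
    by lia.
  split=> [|i]; first by rewrite size_rcons sizeE; lia.
  rewrite -cats1 index_cat mem_first_occurrences ltnS leq_eqVlt.
  case/orP=> [/eqP-> | lt_i].
    by rewrite (negbTE g_notin) /= eqxx addn0 sizeE modn_small; lia.
  rewrite map_f ?mem_iota //; exact: indexE.
case: n Nn gE claim => [|n] Nn gE claim; first by move: k_gt0; rewrite -Nn N0.
have [-> indexE] := claim n (leqnn _); split=> //.
by have := Nstep n; rewrite Nn; lia.
Qed.

(** * Components and arcs *)

(* The local part of [twisted_link_diagram] that both smoothing and reversal  *)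
(* preserve.                                                                  *)
Record well_formed (D : diagram) : Prop := {
  opposite_involutive : involutive (@opposite D);
  kind_opposite : forall d : dart D, kind (opposite d) = kind d;
  edge_involution : involutive (@edge D);
  is_out_opposite : forall d : dart D, is_out (opposite d) = ~~ is_out d;
  classical_rot : forall d : dart D,
    is_classical (kind d) -> is_classical (kind (Defs.rot d));
  is_over_rot : forall d : dart D,
    is_classical (kind d) -> is_over (Defs.rot d) = ~~ is_over d
}.

Lemma travel_injective (D : diagram) : well_formed D -> injective (@travel D).
Proof.
move=> wfD; apply: inj_comp; apply: inv_inj.
  exact: opposite_involutive.
exact: edge_involution.
Qed.

Lemma mem_component (D : diagram) (d e : dart D) :
  (e \in component d) = fconnect (@travel D) d e.
Proof. by rewrite inE. Qed.

Lemma component_eq (D : diagram) (d e : dart D) :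
  well_formed D -> (component d == component e) = fconnect (@travel D) d e.
Proof.
move=> wfD; have sym := fconnect_sym (travel_injective wfD).
apply/eqP/idP => [E | de].
  by rewrite -mem_component E mem_component connect0.
by apply/setP => x; rewrite !mem_component (same_connect sym de).
Qed.

Lemma component_travel (D : diagram) (d : dart D) :
  well_formed D -> component (travel d) = component d.
Proof.
by move=> wfD; apply/eqP; rewrite eq_sym component_eq // fconnect1.
Qed.

Lemma travel_edge (D : diagram) (d : dart D) :
  well_formed D -> travel (edge d) = opposite d.
Proof. by move=> wfD; rewrite /travel edge_involution. Qed.

(** [edge] conjugates [travel] to its inverse: the reversed edges are met in the reversed order. *)
Lemma travel_edge_travel (D : diagram) (d : dart D) :
  well_formed D -> travel (edge (travel d)) = edge d.
Proof. by move=> wfD; rewrite travel_edge // opposite_involutive. Qed.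

Lemma fconnect_travel_edge (D : diagram) (d e : dart D) :
  well_formed D ->
  fconnect (@travel D) (edge d) (edge e) = fconnect (@travel D) d e.
Proof.
move=> wfD; have sym := fconnect_sym (travel_injective wfD).
have main x y :
    fconnect (@travel D) x y -> fconnect (@travel D) (edge x) (edge y).
  move=> /iter_findex <-; elim: (findex _ x y) => //= n IHn.
  apply: connect_trans IHn _; rewrite sym.
  by rewrite -(travel_edge_travel (iter n _ x)) // fconnect1.
apply/idP/idP => [/main | /main //].
by rewrite !edge_involution.
Qed.

Definition bars (D : diagram) (K : {set dart D}) : nat :=
  #|[set e in K | is_bar (kind e)]|.

Lemma edge_component (D : diagram) (d e : dart D) :
  well_formed D -> e \in component d -> edge e \in component (edge d).
Proof. by move=> wfD; rewrite !mem_component fconnect_travel_edge. Qed.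

(** For the backward direction, [edge e] represents the same edge as [e], while [opposite e]
    represents the passage through the same vertex. Bars and crossings are therefore matched by
    [opposite]. *)
Lemma opposite_component (D : diagram) (d e : dart D) :
  well_formed D -> e \in component d -> opposite e \in component (edge d).
Proof.
move=> wfD; rewrite !mem_component -(fconnect_travel_edge _ _ wfD) => de.
by apply: connect_trans de _; rewrite -travel_edge // fconnect1.
Qed.

Lemma bars_component_edge (D : diagram) (d : dart D) :
  well_formed D -> bars (component (edge d)) = bars (component d).
Proof.
move=> wfD; rewrite /bars.
rewrite -(card_imset _ (inv_inj (opposite_involutive wfD))).
apply: eq_card => e; apply/imsetP/idP => [[x] | ].
  rewrite inE => /andP[xd bx] ->; rewrite inE kind_opposite // bx andbT.
  by rewrite -[d](edge_involution wfD) opposite_component.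
rewrite inE => /andP[ed be]; exists (opposite e).
  by rewrite inE kind_opposite // be andbT opposite_component.
by rewrite opposite_involutive.
Qed.

Lemma same_arc_step_component (D : diagram) (d e : dart D) :
  well_formed D -> connect (@same_arc_step D) d e -> component d = component e.
Proof.
move=> wfD /connectP[p]; elim: p d => [|x p IHp] d /=; first by move=> _ ->.
case/andP=> dx /IHp{}IHp /IHp <-.
by case/orP: dx => /andP[/eqP<- _]; rewrite component_travel.
Qed.

Lemma connect_same_arc_sym (D : diagram) : connect_sym (@same_arc_step D).
Proof. by apply: sym_connect_sym => x y; exact: orbC. Qed.

Lemma mem_arc_of (D : diagram) (d : dart D) : d \in arc_of d.
Proof. by rewrite /arc_of; case: ifP => _; rewrite inE connect0. Qed.

Lemma arc_of_component (D : diagram) (d e : dart D) :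
  well_formed D -> e \in arc_of d ->
  component e = component d /\ arc_of e = arc_of d.
Proof.
move=> wfD; rewrite /arc_of -/(bars _); case: ifP => kd.
  rewrite mem_component -component_eq // => /eqP <-.
  by rewrite -/(bars _) kd.
rewrite inE => de; have E := same_arc_step_component wfD de.
rewrite -E -/(bars _) kd; split=> //.
by apply/setP=> x; rewrite !inE (same_connect (@connect_same_arc_sym D) de).
Qed.

(** * Positions of the arcs on a component *)

(** The count starts at [travel d]: a bar at the vertex of [d] lies behind the starting edge and is
    met only at the end of a full turn. *)
Definition bars_met (D : diagram) (d : dart D) (i : nat) : nat :=
  count (fun e => is_bar (kind e)) (traject (@travel D) (travel d) i).

Lemma bars_metS (D : diagram) (d : dart D) (i : nat) :
  bars_met d i.+1 = bars_met d i + is_bar (kind (iter i.+1 (@travel D) d)).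
Proof. by rewrite /bars_met trajectSr -cats1 count_cat /= addn0 -iterSr. Qed.

Lemma bars_met_mono (D : diagram) (d : dart D) (i j : nat) :
  i <= j -> bars_met d i <= bars_met d j.
Proof.
move=> /subnK <-; elim: (j - i) => [|m IHm] //=.
by rewrite addSn (leq_trans IHm) // bars_metS leq_addr.
Qed.

Lemma bars_met_order (D : diagram) (d : dart D) :
  well_formed D -> bars_met d (order (@travel D) d) = bars (component d).
Proof.
move=> wfD; have n_gt0 := order_gt0 (@travel D) d.
have -> : bars (component d) =
    count (fun e => is_bar (kind e)) (orbit (@travel D) d).
  rewrite -size_filter -(card_uniqP (filter_uniq _ (orbit_uniq _ _))).
  by apply: eq_card => e; rewrite inE mem_component fconnect_orbit mem_filter andbC.
(* The two lists differ by a cyclic shift: [d] comes first in the orbit and last in the trajectory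
   from [travel d]. *)
rewrite /bars_met /orbit -(prednK n_gt0) trajectSr trajectS /=.
rewrite -cats1 count_cat -iterSr (prednK n_gt0) (iter_order (travel_injective wfD)) /=.
by rewrite addn0 addnC.
Qed.

Lemma connect_same_bars_met (D : diagram) (d : dart D) (i j : nat) :
  i <= j -> bars_met d i = bars_met d j ->
  connect (@same_arc_step D) (iter i (@travel D) d) (iter j (@travel D) d).
Proof.
move=> /subnK <-; elim: (j - i) => [|m IHm] //=; rewrite addSn => E.
have le1 := bars_met_mono d (leq_addl m i).
have bE := bars_metS d (m + i).
apply: connect_trans (IHm _) (connect1 _); first by lia.
by apply/orP; left; rewrite eqxx; move: bE; rewrite iterS; case: is_bar => /=; lia.
Qed.

(** The reduction sends the stretch after the last bar back to position 0, that of the starting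
    arc. *)
Definition arc_position (D : diagram) (d e : dart D) : nat :=
  bars_met d (findex (@travel D) d e) %% bars (component d).

Lemma arc_position_travel (D : diagram) (d e : dart D) :
  well_formed D -> e \in component d ->
  arc_position d (travel e) =
  (arc_position d e + is_bar (kind (travel e))) %% bars (component d).
Proof.
move=> wfD; rewrite mem_component => de.
have lt_n := findex_max de; have eE := iter_findex de.
rewrite /arc_position modnDml; move: lt_n eE.
(* In the first case [travel e] closes the circle at [d], where the count falls from the number of
   bars to 0. *)
set i := findex _ d e; rewrite leq_eqVlt => /orP[/eqP iE | lt_i] eE.
  have E : travel e = d.
    by rewrite -eE -iterS iE (iter_order (travel_injective wfD)).
  have := bars_metS d i; rewrite iterS eE iE bars_met_order // E => <-.
  by rewrite findex0 /bars_met /= mod0n modnn.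
by rewrite -{1}eE -iterS findex_iter // bars_metS iterS eE.
Qed.

(** A step inside an arc crosses no bar in either direction, so the position is an invariant that
    tells arcs apart. *)
Lemma arc_position_connect (D : diagram) (d x y : dart D) :
  well_formed D -> x \in component d -> connect (@same_arc_step D) x y ->
  arc_position d x = arc_position d y.
Proof.
move=> wfD xd /connectP[p]; elim: p x xd => [|z p IHp] x xd /=.
  by move=> _ ->.
have pos_modK u : arc_position d u %% bars (component d) = arc_position d u.
  by rewrite /arc_position modn_mod.
case/andP=> xz; have [zd pos_xz] : z \in component d /\
    arc_position d x = arc_position d z.
  move: xd; rewrite mem_component -component_eq // => xd.
  case/orP: xz => /andP[/eqP tE nb].
    rewrite mem_component -component_eq // -tE component_travel // xd; split=> //.
    rewrite arc_position_travel ?tE ?(negbTE nb) ?addn0 ?pos_modK //.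
    by rewrite mem_component -component_eq.
  have zd : z \in component d.
    by rewrite mem_component -component_eq // -(component_travel z) // tE.
  split=> //; rewrite -tE arc_position_travel // tE (negbTE nb) addn0.
  by rewrite pos_modK.
by rewrite pos_xz => /(IHp z zd).
Qed.

(* A position on the component at which all the bars have been met lies after *)
(* the last bar, hence on the arc of the starting point.                      *)
Lemma arc_of_eq (D : diagram) (d : dart D) (i j : nat) :
  well_formed D -> 1 < bars (component d) ->
  i < order (@travel D) d -> j < order (@travel D) d ->
  (arc_of (iter i (@travel D) d) == arc_of (iter j (@travel D) d)) =
  (bars_met d i == bars_met d j %[mod bars (component d)]).
Proof.
move=> wfD k_gt1 lt_i lt_j.
have in_d m : iter m (@travel D) d \in component d.
  by rewrite mem_component fconnect_iter.
have arcE m : arc_of (iter m (@travel D) d) =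
    [set e | connect (@same_arc_step D) (iter m (@travel D) d) e].
  have := fconnect_iter (@travel D) m d; rewrite -component_eq // => /eqP E.
  by rewrite /arc_of -E -/(bars _) leqNgt k_gt1.
have sym := @connect_same_arc_sym D.
have -> : (arc_of (iter i (@travel D) d) == arc_of (iter j (@travel D) d)) =
    connect (@same_arc_step D) (iter i (@travel D) d) (iter j (@travel D) d).
  rewrite !arcE; apply/eqP/idP => [/setP/(_ (iter j (@travel D) d)) | ij].
    by rewrite !inE connect0.
  by apply/setP=> x; rewrite !inE (same_connect sym ij).
apply/idP/eqP => [/(arc_position_connect wfD (in_d i)) | eq_mod].
  by rewrite /arc_position !findex_iter.
have canonical m : m < order (@travel D) d ->
    exists m', bars_met d m' = bars_met d m %% bars (component d) /\
    connect (@same_arc_step D)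
      (iter m (@travel D) d) (iter m' (@travel D) d).
  move=> lt_m; have := bars_met_mono d (ltnW lt_m).
  rewrite bars_met_order // leq_eqVlt => /orP[/eqP mE | ltk].
    exists 0; rewrite mE modnn; split=> //.
    (* The start is read as the end of a full turn, where all bars have been met as well. *)
    rewrite -[iter 0 _ d](iter_order (travel_injective wfD)).
    by apply: connect_same_bars_met; rewrite ?(ltnW lt_m) // bars_met_order.
  by exists m; rewrite modn_small.
have [i' [iE ii']] := canonical i lt_i; have [j' [jE jj']] := canonical j lt_j.
apply: connect_trans ii' _; rewrite sym; apply: connect_trans jj' _.
have [le_ij | /ltnW le_ji] := leqP i' j'; first rewrite sym;
  by apply: connect_same_bars_met; rewrite // iE jE eq_mod.
Qed.

Lemma mem_arcs_from (D : diagram) (d : dart D) :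
  arcs_from d =i arcs (component d).
Proof.
move=> C; rewrite mem_first_occurrences; apply/mapP/imsetP => -[e].
  by rewrite -fconnect_orbit -mem_component => ed ->; exists e.
by rewrite mem_component fconnect_orbit => ed ->; exists e.
Qed.

Lemma size_arcs_from (D : diagram) (d : dart D) :
  size (arcs_from d) = #|arcs (component d)|.
Proof.
rewrite -(card_uniqP (first_occurrences_uniq _)).
by apply: eq_card; apply: mem_arcs_from.
Qed.

(** By [arc_of_eq], the arcs met along the orbit satisfy the hypotheses of
    [cyclic_first_occurrences] with [bars_met d] as counter. *)
Lemma arcs_from_bars (D : diagram) (d : dart D) :
  well_formed D -> 1 < bars (component d) ->
  #|arcs (component d)| = bars (component d) /\
  forall e, e \in component d ->
    index (arc_of e) (arcs_from d) = arc_position d e.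
Proof.
move=> wfD k_gt1.
have step i : bars_met d i <= bars_met d i.+1 <= (bars_met d i).+1.
  by rewrite bars_metS; case: is_bar; lia.
have := cyclic_first_occurrences (ltnW k_gt1) (erefl : bars_met d 0 = 0) step
  (bars_met_order d wfD) (fun i j => @arc_of_eq D d i j wfD k_gt1).
have -> : mkseq (fun i => arc_of (iter i (@travel D) d)) (order (@travel D) d) =
    [seq arc_of e | e <- orbit (@travel D) d].
  apply: (@eq_from_nth _ set0) => [|i]; rewrite size_mkseq ?size_map ?size_orbit //.
  move=> lt_i; rewrite nth_mkseq // (nth_map d) ?size_orbit //.
  by rewrite /orbit nth_traject.
rewrite -/(arcs_from d) size_arcs_from => -[-> indexE]; split=> // e.
rewrite mem_component => de.
by rewrite -{1}(iter_findex de) indexE ?findex_max.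
Qed.

Lemma arcs_from_unbarred (D : diagram) (d e : dart D) :
  well_formed D -> bars (component d) <= 1 -> e \in component d ->
  index (arc_of e) (arcs_from d) = 0.
Proof.
move=> wfD k_le1 ed.
have arcE x : x \in component d -> arc_of x = component d.
  rewrite mem_component -component_eq // => /eqP E.
  by rewrite /arc_of -E -/(bars _) k_le1.
have : size (arcs_from d) <= 1.
  rewrite size_arcs_from -(cards1 (component d)) subset_leq_card //.
  by apply/subsetP => C /imsetP[x /arcE -> ->]; rewrite inE.
have : arc_of e \in arcs_from d by rewrite mem_arcs_from imset_f.
by rewrite -index_mem => lt_i /(leq_trans lt_i); rewrite ltnS leqn0 => /eqP.
Qed.

(** * Alternation of the arcs *)

(** The two-colouring of the component by the parity of arc positions; on colour [true] the roles of
    O and U are exchanged. *)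
Definition alternation (D : diagram) (d e : dart D) : bool :=
  odd (index (arc_of e) (arcs_from d)).

Definition alternating (D : diagram) (K : {set dart D}) : bool :=
  (bars K <= 1) || ~~ odd (bars K).

Lemma alternating_arcs (D : diagram) (d : dart D) :
  well_formed D ->
  #|arcs (component d)| = 1 \/ ~~ odd #|arcs (component d)| ->
  alternating (component d).
Proof.
rewrite /alternating => wfD; have [//|k_gt1] := leqP.
by have [-> _] := arcs_from_bars wfD k_gt1; case=> // kE; rewrite kE in k_gt1.
Qed.

(** This is where evenness enters: reduction modulo an even number keeps parity, so the colour flips
    at every bar even where the circle closes. *)
Lemma alternation_travel (D : diagram) (d e : dart D) :
  well_formed D -> alternating (component d) -> e \in component d ->
  alternation d (travel e) =
  alternation d e (+) ((1 < bars (component d)) && is_bar (kind (travel e))).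
Proof.
rewrite /alternation /alternating => wfD alt ed.
have ted : travel e \in component d.
  by move: ed; rewrite !mem_component => /connect_trans -> //; rewrite fconnect1.
have [k_le1 | k_gt1] := leqP; first by rewrite !arcs_from_unbarred.
rewrite leqNgt k_gt1 /= in alt.
have [_ indexE] := arcs_from_bars wfD k_gt1.
rewrite !indexE // arc_position_travel //.
have odd_mod m : odd (m %% bars (component d)) = odd m.
  by rewrite [in RHS](divn_eq m (bars (component d))) oddD oddM (negbTE alt) andbF.
by rewrite odd_mod oddD; case: is_bar.
Qed.

Lemma alternation_start (D : diagram) (d : dart D) :
  well_formed D -> alternation d d = false.
Proof.
move=> wfD; have dd : d \in component d by rewrite mem_component connect0.
rewrite /alternation; have [k_le1 | k_gt1] := leqP (bars (component d)) 1.
  by rewrite arcs_from_unbarred.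
have [_ indexE] := arcs_from_bars wfD k_gt1.
by rewrite indexE // /arc_position findex0 mod0n.
Qed.

(** Going from [edge (travel x)] to [edge x] passes the same vertex as going from [x] to [travel x],
    so both colourings obey the same flip rule. They agree at [a], because no bar separates [a] from
    the backward starting edge. *)
Lemma alternation_edge (D : diagram) (a e : dart D) :
  well_formed D -> alternating (component a) -> ~~ is_bar (kind (travel a)) ->
  e \in component a ->
  alternation (edge (travel a)) (edge e) = alternation a e.
Proof.
move=> wfD alt nb ea.
have edge_comp x : x \in component a ->
    edge x \in component (edge (travel a)).
  by move=> xa; apply: edge_component; rewrite ?component_travel.
have barsE : bars (component (edge (travel a))) = bars (component a).
  by rewrite bars_component_edge // component_travel.
have alt' : alternating (component (edge (travel a))).
  by rewrite /alternating barsE.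
have step x : x \in component a ->
    alternation (edge (travel a)) (edge (travel x)) =
    alternation (edge (travel a)) (edge x)
      (+) ((1 < bars (component a)) && is_bar (kind (travel x))).
  move=> xa; have txa : travel x \in component a.
    by move: xa; rewrite !mem_component => /connect_trans -> //; rewrite fconnect1.
  have := alternation_travel wfD alt' (edge_comp _ txa).
  rewrite barsE travel_edge_travel // => ->.
  by rewrite /travel kind_opposite // -addbA addbb addbF.
have start : alternation (edge (travel a)) (edge a) = false.
  have := step a; rewrite (negbTE nb) andbF addbF alternation_start // => <- //.
  by rewrite mem_component connect0.
move: ea; rewrite mem_component => /iter_findex <-.
elim: (findex _ a e) => [|n IHn] /=; first by rewrite start alternation_start.
have na : iter n (@travel D) a \in component a.
  by rewrite mem_component fconnect_iter.
by rewrite step // IHn -alternation_travel.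
Qed.

(** The value [true] of [b] gives O_L and [false] gives U_L. *)
Definition linking_set (D : diagram) (d : dart D) (b : bool) :
    {set {set dart D}} :=
  [set x in crossings D | linking x &
     [exists e in x, (e \in component d) && (is_over e (+) alternation d e == b)]].

(** The listed arcs are distinct, so the only position whose arc contains [e] is the index of
    [arc_of e]; the union over positions becomes a condition on single darts. *)
Lemma linking_setP (D : diagram) (d : dart D) (b : bool)
    (F : nat -> {set dart D} -> {set {set dart D}}) :
  well_formed D ->
  (forall i C, F i C = [set x in crossings D |
     linking x & [exists e in x, (e \in C) && (is_over e (+) odd i == b)]]) ->
  \bigcup_(i < size (arcs_from d)) F i (nth set0 (arcs_from d) i) =
  linking_set d b.
Proof.
move=> wfD FE; apply/setP => x; apply/bigcupP/idP => [[i _] | ].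
  rewrite FE !inE => /and3P[-> -> /exists_inP[e ex /andP[eC eb]]] /=.
  apply/exists_inP; exists e => //.
  have : nth set0 (arcs_from d) i \in arcs_from d by rewrite mem_nth.
  rewrite mem_arcs_from => /imsetP[z zd CE]; rewrite CE in eC.
  have [ez arcE] := arc_of_component wfD eC.
  move: zd; rewrite mem_component -component_eq // -ez component_eq // => de.
  rewrite mem_component de /alternation arcE -CE.
  by rewrite index_uniq ?first_occurrences_uniq.
rewrite !inE => /and3P[xD lx /exists_inP[e ex /andP[ed eb]]].
have lt_i : index (arc_of e) (arcs_from d) < size (arcs_from d).
  by rewrite index_mem mem_arcs_from imset_f.
exists (Ordinal lt_i) => //=; rewrite FE !inE xD lx /=.
apply/exists_inP; exists e => //.
by rewrite nth_index -?index_mem // mem_arc_of.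
Qed.

Lemma OL_linking_set (D : diagram) (d : dart D) :
  well_formed D -> OL d = linking_set d true.
Proof.
move=> wfD; pose F i C : {set {set dart D}} :=
  if odd i then under_set C else over_set C.
apply: (@linking_setP D d true F) => // i C; apply/setP => x; rewrite /F.
case: (odd i); rewrite !inE; congr [&& _, _ & _];
  apply: eq_existsb => e; congr [&& _, _ & _].
- by rewrite addbT; case: is_over.
- by rewrite addbF; case: is_over.
Qed.

Lemma UL_linking_set (D : diagram) (d : dart D) :
  well_formed D -> UL d = linking_set d false.
Proof.
move=> wfD; pose F i C : {set {set dart D}} :=
  if odd i then over_set C else under_set C.
apply: (@linking_setP D d false F) => // i C; apply/setP => x; rewrite /F.
case: (odd i); rewrite !inE; congr [&& _, _ & _];
  apply: eq_existsb => e; congr [&& _, _ & _].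
- by rewrite addbT; case: is_over.
- by rewrite addbF; case: is_over.
Qed.

(** * Reversal *)

Lemma well_formed_reverse (D : diagram) :
  well_formed D -> well_formed (reverse D).
Proof.
case=> oppK kind_opp edgeK out_opp cl over; split=> //= d.
exact: (congr1 negb (out_opp d)).
Qed.

Lemma crossing_rot (D : diagram) (x : {set dart D}) (d : dart D) :
  well_formed D -> x \in crossings D -> d \in x ->
  is_classical (kind d) /\ Defs.rot d \in x.
Proof.
move=> wfD /imsetP[d0 kd0 ->]; rewrite !inE => dd0; split; last first.
  by apply: connect_trans dd0 _; rewrite fconnect1.
rewrite -(iter_findex dd0); elim: findex => //= n IHn.
exact: classical_rot.
Qed.

Lemma classical_opposite (D : diagram) (d : dart D) :
  is_classical (kind d) -> opposite d = Defs.rot (Defs.rot d).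
Proof. by rewrite /opposite; case: (kind d). Qed.

Lemma crossing_opposite (D : diagram) (x : {set dart D}) (d : dart D) :
  well_formed D -> x \in crossings D -> d \in x -> opposite d \in x.
Proof.
move=> wfD xD dx; have [kd rx] := crossing_rot wfD xD dx.
by rewrite classical_opposite //; have [] := crossing_rot wfD xD rx.
Qed.

Lemma is_over_opposite (D : diagram) (d : dart D) :
  well_formed D -> is_classical (kind d) -> is_over (opposite d) = is_over d.
Proof.
move=> wfD kd; rewrite classical_opposite //.
by rewrite !is_over_rot ?negbK // classical_rot.
Qed.

(** At a crossing, [opposite] exchanges the outgoing darts of the two orientations, and it preserves
    whether two darts lie on one component. *)
Lemma linking_reverse (D : diagram) (x : {set dart D}) :
  well_formed D -> x \in crossings D -> @linking (reverse D) x = linking x.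
Proof.
move=> wfD xD.
have compE (d e : dart D) :
    (component (opposite d) == component (opposite e)) =
    (component d == component e).
  rewrite -!travel_edge // !component_travel // !component_eq //.
  exact: fconnect_travel_edge.
have oppx := crossing_opposite wfD xD.
apply/exists_inP/exists_inP => -[d dx /exists_inP[e ex /and3P[od oe de]]];
  exists (opposite d); rewrite ?oppx //; apply/exists_inP;
  exists (opposite e); rewrite ?oppx //.
- by rewrite !is_out_opposite // compE; apply/and3P.
- by rewrite /= !is_out_opposite // !negbK od oe /= [_ == _]compE.
Qed.

(** At a crossing, [opposite] is a half turn: it commutes with [rot], keeps [is_over] and negates
    [is_out], so it carries a witness for one orientation to a witness for the other. *)
Lemma sgn_reverse (D : diagram) (x : {set dart D}) :
  well_formed D -> x \in crossings D -> @sgn (reverse D) x = sgn x.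
Proof.
move=> wfD xD; rewrite /sgn; congr (if _ then _ else _).
have opp d : d \in x -> [/\ opposite d \in x, is_over (opposite d) = is_over d,
    is_out (opposite d) = ~~ is_out d &
    is_out (Defs.rot (opposite d)) = ~~ is_out (Defs.rot d)].
  move=> dx; have [kd rx] := crossing_rot wfD xD dx.
  have [kr _] := crossing_rot wfD xD rx.
  rewrite crossing_opposite // is_over_opposite // is_out_opposite //; split=> //.
  by rewrite -is_out_opposite // (classical_opposite kr) (classical_opposite kd).
apply/exists_inP/exists_inP => -[d /opp[ox overE outE rotE] /and3P[od dd rd]];
  exists (opposite d) => //.
- by rewrite overE outE rotE; apply/and3P.
- by rewrite /= overE outE rotE !negbK; apply/and3P.
Qed.

Lemma linking_set_reverse (D : diagram) (a : dart D) (b : bool) :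
  well_formed D -> alternating (component a) -> ~~ is_bar (kind (travel a)) ->
  @linking_set (reverse D) (edge (travel a)) b = linking_set a b.
Proof.
move=> wfD alt nb.
suff main (x : {set dart D}) :
    (x \in @linking_set (reverse D) (edge (travel a)) b) = (x \in linking_set a b).
  by apply/setP.
rewrite /linking_set [LHS]inE [RHS]inE -/(crossings D).
have [xD|//] := boolP (x \in crossings D); rewrite linking_reverse //=.
congr (_ && _).
(* Here [opposite e] is [travel (edge e)], and the vertex passed is classical, so no flip occurs
   between [edge e] and [opposite e]. *)
have bE (e : dart D) : e \in x -> e \in component a ->
    alternation (edge (travel a)) (opposite e) = alternation a e.
  move=> ex ea; rewrite -(alternation_edge wfD alt nb ea).
  have edge_comp : edge e \in component (edge (travel a)).
    by apply: edge_component; rewrite ?component_travel.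
  have alt' : alternating (component (edge (travel a))).
    by rewrite /alternating bars_component_edge // component_travel.
  rewrite -travel_edge // alternation_travel // travel_edge // kind_opposite //.
  by have [] := crossing_rot wfD xD ex; case: (kind e) => //; rewrite andbF addbF.
have overE (e : dart D) : e \in x -> is_over (opposite e) = is_over e.
  by move=> ex; apply: is_over_opposite => //; have [] := crossing_rot wfD xD ex.
have oppx (e : dart D) : e \in x -> opposite e \in x.
  exact: crossing_opposite.
have to_a (e : dart D) :
    e \in component (edge (travel a)) -> opposite e \in component a.
  move=> ec; rewrite -(component_travel a) // -[travel a](edge_involution wfD).
  exact: opposite_component.
have from_a (e : dart D) :
    e \in component a -> opposite e \in component (edge (travel a)).
  by move=> ea; apply: opposite_component; rewrite ?component_travel.
have bE' (e : dart D) : e \in x -> e \in component (edge (travel a)) ->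
    alternation a (opposite e) = alternation (edge (travel a)) e.
  by move=> ex ec; rewrite -bE ?oppx ?to_a // opposite_involutive.
apply/exists_inP/exists_inP => -[e ex /andP[ec eb]];
  exists (@opposite D e); try exact: oppx; apply/andP; split.
- exact: to_a.
- by rewrite bE' ?overE.
- exact: from_a.
- rewrite overE //; move: eb; rewrite -bE //.
Qed.

Lemma index_at_reverse (D : diagram) (a : dart D) :
  well_formed D -> alternating (component a) -> ~~ is_bar (kind (travel a)) ->
  @index_at (reverse D) (edge (travel a)) = index_at a.
Proof.
move=> wfD alt nb; have wfR := well_formed_reverse wfD.
rewrite /index_at (OL_linking_set _ wfR) (UL_linking_set _ wfR).
rewrite !linking_set_reverse // OL_linking_set // UL_linking_set //.
by congr (_ - _)%R; apply: eq_bigr => x; rewrite inE => /andP[xD _];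
  rewrite sgn_reverse.
Qed.

(** * Smoothing *)

Lemma opposite_opposite (D : diagram) (d : dart D) :
  twisted_link_diagram D -> opposite (opposite d) = d.
Proof.
move=> tD; have kE n : kind (iter n (@Defs.rot D) d) = kind d.
  by elim: n => //= n <-; rewrite kind_rot.
rewrite {1}/opposite kE /opposite -iterD -[RHS](iter_order (rot_injective tD)).
by rewrite order_rot //; case: (kind d).
Qed.

Lemma well_formed_twisted (D : diagram) :
  twisted_link_diagram D -> well_formed D.
Proof.
move=> tD; split.
- by move=> d; apply: opposite_opposite.
- by move=> d; rewrite /opposite; elim: (_./2) => //= n; rewrite kind_rot.
- exact: (edge_involutive tD).
- exact: (out_opposite tD).
- by move=> d; rewrite kind_rot.
- exact: (over_rot tD).
Qed.

Lemma opposite_smoothing (D : diagram) (c : {set dart D}) (d : dart D) :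
  @opposite (smoothing c) d =
  if d \in c then
    if is_out (Defs.rot d) == is_out d then iter 3 (@Defs.rot D) d
    else Defs.rot d
  else iter (valence (kind d))./2 (@Defs.rot (smoothing c)) d.
Proof.
rewrite /opposite [@kind (smoothing c) d]/=.
by case: ifP => //= ->.
Qed.

(** Neighbouring darts of a crossing lie on different strands, and the smoothed [rot] picks the
    neighbour of opposite orientation. The change of strand is what exchanges the two indices. *)
Lemma opposite_smoothing_in (D : diagram) (c : {set dart D}) (d : dart D) :
  twisted_link_diagram D -> c \in crossings D -> d \in c ->
  [/\ @opposite (smoothing c) d \in c,
      is_over (@opposite (smoothing c) d : dart D) = ~~ is_over d,
      is_out (@opposite (smoothing c) d : dart D) = ~~ is_out d &
      @opposite (smoothing c) (@opposite (smoothing c) d) = d].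
Proof.
move=> tD cD dc; have wfD := well_formed_twisted tD.
have [k0 c1] := crossing_rot wfD cD dc; have [k1 c2] := crossing_rot wfD cD c1.
have [k2 c3] := crossing_rot wfD cD c2.
have out2 : is_out (Defs.rot (Defs.rot d)) = ~~ is_out d.
  by rewrite -classical_opposite ?is_out_opposite.
have out3 : is_out (Defs.rot (Defs.rot (Defs.rot d))) = ~~ is_out (Defs.rot d).
  by rewrite -classical_opposite ?is_out_opposite.
have rot4 : Defs.rot (Defs.rot (Defs.rot (Defs.rot d))) = d.
  by rewrite -classical_opposite // -classical_opposite // opposite_opposite.
rewrite (opposite_smoothing c d) dc; case: eqP => [oE | oE].
  rewrite opposite_smoothing /= c3 rot4 out3 oE !is_over_rot // !negbK.
  by split=> //; case: is_out.
rewrite opposite_smoothing c1 /= out2 rot4 is_over_rot //.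
by move: oE; split=> //; move: oE; do 2?case: is_out.
Qed.

Lemma well_formed_smoothing (D : diagram) (c : {set dart D}) :
  twisted_link_diagram D -> c \in crossings D -> well_formed (smoothing c).
Proof.
move=> tD cD; have wfD := well_formed_twisted tD.
(* As [c] is a full orbit of [rot], darts outside it keep their opposites, which also stay
   outside. *)
have rot_c d : (Defs.rot d \in c) = (d \in c).
  case/imsetP: cD => d0 _ ->; have sym := fconnect_sym (rot_injective tD).
  rewrite !inE ![fconnect _ d0 _]sym; symmetry; apply: same_connect => //.
  by rewrite fconnect1.
have oppN (d : dart D) : d \notin c ->
    @opposite (smoothing c) d = @opposite D d /\ @opposite D d \notin c.
  move=> dc; have iter_c n : iter n (@Defs.rot D) d \notin c.
    by elim: n => //= n; rewrite rot_c.
  rewrite opposite_smoothing (negbTE dc) /opposite; split=> //.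
  by elim: (_./2) => //= n ->; rewrite (negbTE (iter_c n)).
split.
- move=> d; have [dc | dc] := boolP ((d : dart D) \in c).
    by have [] := opposite_smoothing_in tD cD dc.
  by have [E oc] := oppN d dc; rewrite E; have [-> _] := oppN _ oc; exact: (@opposite_opposite D d tD).
- move=> d; have [dc | dc] := boolP ((d : dart D) \in c).
    by have [oc _ _ _] := opposite_smoothing_in tD cD dc; rewrite /= oc dc.
  have [-> oc] := oppN d dc.
  by rewrite /= (negbTE oc) (negbTE dc) kind_opposite.
- exact: (edge_involutive tD).
- move=> d; have [dc | dc] := boolP ((d : dart D) \in c).
    by have [] := opposite_smoothing_in tD cD dc.
  by have [-> _] := oppN d dc; exact: (out_opposite tD).
- move=> d /=; case: ifP => // dc kd.
  by rewrite rot_c dc kind_rot.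
- move=> d /=; case: ifP => // dc kd.
  by rewrite /= over_rot.
Qed.

(** Strand and orientation distinguish the four darts of a crossing, so the [pick] in [Ind] has at
    most one candidate. *)
Lemma same_over_out (D : diagram) (c : {set dart D}) (d e : dart D) :
  twisted_link_diagram D -> c \in crossings D -> d \in c -> e \in c ->
  is_over d = is_over e -> is_out d = is_out e -> d = e.
Proof.
move=> tD cD dc ec; have wfD := well_formed_twisted tD.
have [k0 c1] := crossing_rot wfD cD dc; have [k1 c2] := crossing_rot wfD cD c1.
have [k2 c3] := crossing_rot wfD cD c2.
have de : fconnect (@Defs.rot D) d e.
  case/imsetP: cD dc ec => d0 _ ->; have sym := fconnect_sym (rot_injective tD).
  by rewrite !inE => d0d; rewrite (same_connect sym d0d).
have := findex_max de; have := iter_findex de; rewrite order_rot //.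
have -> : valence (kind d) = 4 by case: (kind d) k0.
case: (findex _ d e) => [|[|[|[|//]]]] /= <- // _.
- by rewrite is_over_rot //; case: is_over.
- by rewrite -classical_opposite // is_out_opposite //; case: is_out.
- by rewrite !is_over_rot //; case: is_over.
Qed.

(** The two diagrams differ only in the test inside [rot], which compares negated orientations; the
    tests agree pointwise, hence the appeal to extensionality. *)
Lemma index_at_smoothing_reverse (D : diagram) (c : {set dart D}) (d : dart D) :
  @index_at (@smoothing (reverse D) c) d = @index_at (reverse (smoothing c)) d.
Proof.
have rotE : @Defs.rot (@smoothing (reverse D) c) = @Defs.rot (smoothing c).
  by apply: functional_extensionality => e /=; rewrite (inj_eq negb_inj).
exact: (congr1 (fun r => @index_at (@Diagram (dart D) (@kind (smoothing c)) r
  (@edge D) (@is_over D) (fun e => ~~ is_out e)) d) rotE).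
Qed.

Lemma Ind_reverse (D : diagram) (b : bool) (c : {set dart D}) :
  twisted_link_diagram D -> c \in crossings D ->
  (forall K : {set dart (smoothing c)}, K \in components (smoothing c) ->
     #|arcs K| = 1 \/ ~~ odd #|arcs K|) ->
  @Ind (reverse D) b c = @Ind D (~~ b) c.
Proof.
move=> tD cD arcsD; rewrite /Ind /=.
have wfS := well_formed_smoothing tD cD.
(* If the reversed diagram offers no base dart, neither does the original one, since the smoothed
   [opposite] would carry one to the other; both indices are then 0. *)
case: pickP => [d' /and3P[d'c /eqP ov' out'] | none]; last first.
  case: pickP => // d /and3P[dc /eqP ov out].
  have [oc oov oout _] := opposite_smoothing_in tD cD dc.
  have := none (@opposite (smoothing c) d); rewrite oc /= oov oout ov out.
  by rewrite !negbK eqxx.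
rewrite negbK in out'.
have [dc ov out _] := opposite_smoothing_in tD cD d'c.
(* [d'] leaves [c] in the original orientation, so its partner [d] enters [c] on the other strand:
   it is the base dart of the other index. *)
set d : dart D := @opposite (smoothing c) d' in dc ov out.
case: pickP => [e /and3P[ec /eqP ov_e out_e] | /(_ d)]; last first.
  by rewrite dc ov out ov' out' eqxx.
have -> : e = d.
  apply: (same_over_out tD cD) => //; first by rewrite ov ov'.
  by rewrite out out' (negbTE out_e).
rewrite index_at_smoothing_reverse.
(* With [edge d] as starting edge, the backward starting edge [edge (travel (edge d))] is [edge d'],
   the base edge of the reversed diagram; the vertex between them is plain. *)
have travelE : @travel (smoothing c) (edge d) = d'.
  by rewrite travel_edge // opposite_involutive.
rewrite -[in LHS]travelE; apply: index_at_reverse => //.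
- apply: alternating_arcs => //; apply: arcsD; apply/imsetP.
  by exists (edge d) => //; rewrite inE /= out_edge // out out'.
- by rewrite travelE /= d'c.
Qed.

Theorem theorem3p20 (D : diagram)
  (knotD : twisted_knot_diagram D)
  (arcsD : forall c : {set dart D}, c \in crossings D ->
     forall K : {set dart (smoothing c)}, K \in components (smoothing c) ->
       #|arcs K| = 1 \/ ~~ odd #|arcs K|) :
  Bpoly (reverse D) = Bpoly D.
Proof.
have [tD _] := knotD.
(* [crossings] ignores the orientation, so the two sums run over the same set and are compared term
   by term. *)
apply: eq_bigr => c cD; rewrite sgn_reverse //; last exact: well_formed_twisted.
have -> : @Ind1 (reverse D) c = @Ind2 D c := Ind_reverse false tD cD (arcsD c cD).
have -> : @Ind2 (reverse D) c = @Ind1 D c := Ind_reverse true tD cD (arcsD c cD).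
by rewrite (addrC (@Ind2 D c)).
Qed.
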